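(* The algorithm SIPP is incomplete when the agent is subject to kinodynamic constraints and wait actions are not available at every configuration. That is, there exists a problem instance $(G,w,\mathrm{vel},SI,v_{start},t_{start},v_{goal})$, with accelerating and decelerating edges and with vertices of nonzero velocity (at which waiting is not allowed), for which a feasible collision-free trajectory from $v_{start}$ (starting at time $t_{start}$) to $v_{goal}$ exists, but on which SIPP terminates without returning a solution.
   Context: **Problem.** Time is discrete, $T=\{0,1,2,\dots\}$. An instance consists of: a directed graph $G=(V,E)$ in which each vertex has finitely many outgoing edges and each edge $e=(v,u)$ has $u\neq v$; a duration $w(e)\in\mathbb{N}$, $w(e)\ge 1$, for each edge; a velocity $\mathrm{vel}(v)\ge 0$ for each vertex (part of the agent's configuration; the agent may wait only at vertices with $\mathrm{vel}(v)=0$); for each vertex $v$ a finite sequence $SI(v)$ of pairwise disjoint intervals of time steps (safe intervals; an interval is $[a,b]=\{t\in T: a\le t\le b\}$, with $b=\infty$ allowed), any two of which are separated by at least one time step not in any of them; for each edge $e$ a finite sequence $SI(e)$ of pairwise disjoint intervals; vertices $v_{start},v_{goal}$; and a start time $t_{start}\in T$ lying in a safe interval of $v_{start}$. Write $t\in SI(x)$ if $t$ lies in some interval of $SI(x)$. An edge $e=(v,u)$ is accelerating if $\mathrm{vel}(u)>\mathrm{vel}(v)$, decelerating if $\mathrm{vel}(u)<\mathrm{vel}(v)$, uniform if $\mathrm{vel}(u)=\mathrm{vel}(v)$. A transition $(e,t)$ with $e=(v,u)$ is collision-free if $t\in SI(e)$ and $t+w(e)\in SI(u)$. A trajectory is a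 finite sequence $\pi=(e_1,t_1),\dots,(e_L,t_L)$ with $t_i\in T$ the starting time of the move $e_i$. It is feasible from $(v_{start},t_{start})$ to $v_{goal}$ if: the source of $e_1$ is $v_{start}$ and the target of $e_L$ is $v_{goal}$; the target of $e_i$ equals the source of $e_{i+1}$; $t_1\ge t_{start}$ and $t_{i+1}\ge t_i+w(e_i)$; and whenever one of these inequalities is strict (i.e. the agent waits), the vertex at which the wait takes place (the source of $e_1$, resp. of $e_{i+1}$) has velocity $0$. It is collision-free if every transition $(e_i,t_i)$ is collision-free and whenever the agent waits at a vertex $v$ from time $a$ to time $b$, all time steps $a,a+1,\dots,b$ lie in $SI(v)$. **SIPP (Safe Interval Path Planning), applying only kinodynamically valid actions.** A search node is a pair $n=(v,[lb,ub])$ where $[lb,ub]$ is a safe interval of $v$; with each generated node the algorithm stores the earliest arrival time found so far, $t(n)\in[lb,ub]$, which is its $g$-value. The start node is $v_{start}$ with its safe interval containing $t_{start}$, and $t(n_{start})=t_{start}$. The search is best-first in the style of A*, repeatedly extracting from OPEN a node minimizing $t(n)+h(v)$, where $h:V\to[0,\infty)$ is an admissible and consistent heuristic (estimate of the remaining travel time to $v_{goal}$). When a node with vertex $v_{goal}$ is extracted, a solution is returned. Otherwise the node $n=(v,[lb,ub])$ is expanded: for each outgoing edge $e=(v,u)$ and each safe interval $[lb',ub']$ of $u$, let $\tau$ be the earliest departure time such that $(e,\tau)$ is collision-free and $\tau+w(e)\in[lb',ub']$, where $\tau$ ranges over $[t(n),ub]$ if $\mathrm{vel}(v)=0$ (wait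 and move) and only $\tau=t(n)$ is permitted if $\mathrm{vel}(v)\ne0$; if such $\tau$ exists, the successor $n'=(u,[lb',ub'])$ is generated with arrival time $\tau+w(e)$, being inserted in OPEN if new or having $t(n')$ and its parent updated if the new arrival time is smaller; if no such $\tau$ exists no successor is generated. If OPEN becomes empty, the algorithm terminates reporting failure. *)

(* Defs.v *)
From mathcomp Require Import all_boot all_order all_algebra.
From mathcomp Require Import reals.
From Stdlib Require Import Relation_Operators.

Set Implicit Arguments.
Unset Strict Implicit.
Unset Printing Implicit Defensive.

Import Order.TTheory GRing.Theory Num.Theory.

(* Time steps are natural numbers.  The pair [(a, Some b)] stands for the
   interval [a, b] of time steps, [(a, None)] for [a, oo). *)
Definition tinterval := (nat * option nat)%type.

Definition tmem (t : nat) (J : tinterval) : bool :=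
  (J.1 <= t) && (if J.2 is Some b then t <= b else true).

Definition in_SI (t : nat) (S : seq tinterval) : bool := has (tmem t) S.

Definition nonempty_itvs (S : seq tinterval) : Prop :=
  forall J, J \in S -> exists t, tmem t J.

Definition disjoint_itvs (S : seq tinterval) : Prop :=
  forall J K, J \in S -> K \in S -> J != K -> forall t, ~~ (tmem t J && tmem t K).

Definition itv_before (J : tinterval) (t : nat) : Prop :=
  forall x, tmem x J -> x < t.

Definition itv_after (J : tinterval) (t : nat) : Prop :=
  forall x, tmem x J -> t < x.

Definition separated_itvs (S : seq tinterval) : Prop :=
  forall J K, J \in S -> K \in S -> J != K ->
  exists2 t, ~~ in_SI t S &
    (itv_before J t /\ itv_after K t) \/ (itv_before K t /\ itv_after J t).

(* An edge (v, u) is an ordered pair of vertices; [dur] and [SIe] are only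
   meaningful on the pairs satisfying [edge].  Intervals are taken nonempty, so
   that pairwise disjointness of a sequence includes its duplicate-freeness. *)
Record instance (R : realType) := Instance {
  vertex : eqType;
  edge : pred (vertex * vertex);
  dur : vertex * vertex -> nat;
  vel : vertex -> R;
  SIv : vertex -> seq tinterval;
  SIe : vertex * vertex -> seq tinterval;
  vstart : vertex;
  vgoal : vertex;
  tstart : nat;
  edge_finite : forall v, exists s : seq vertex,
    forall u, edge (v, u) -> u \in s;
  edge_irrefl : forall e, edge e -> e.2 != e.1;
  dur_ge1 : forall e, edge e -> 1 <= dur e;
  vel_ge0 : forall v, (0 <= vel v)%R;
  SIv_uniq : forall v, uniq (SIv v);
  SIv_nonempty : forall v, nonempty_itvs (SIv v);
  SIv_disjoint : forall v, disjoint_itvs (SIv v);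
  SIv_separated : forall v, separated_itvs (SIv v);
  SIe_uniq : forall e, edge e -> uniq (SIe e);
  SIe_nonempty : forall e, edge e -> nonempty_itvs (SIe e);
  SIe_disjoint : forall e, edge e -> disjoint_itvs (SIe e);
  tstart_safe : in_SI tstart (SIv vstart)
}.

Definition accelerating (R : realType) (I : instance R)
  (e : vertex I * vertex I) : Prop := (vel e.1 < vel e.2)%R.

Definition decelerating (R : realType) (I : instance R)
  (e : vertex I * vertex I) : Prop := (vel e.2 < vel e.1)%R.

Definition collision_free_transition (R : realType) (I : instance R)
    (e : vertex I * vertex I) (t : nat) : Prop :=
  in_SI t (SIe e) /\ in_SI (t + dur e) (SIv e.2).

Definition trajectory (R : realType) (I : instance R) :=
  seq ((vertex I * vertex I) * nat).

(* [moves g v t p]: the agent, present at v at time t, can follow p to g.  The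
   empty sequence is allowed here, for an agent already at g. *)
Fixpoint moves (R : realType) (I : instance R) (g v : vertex I) (t : nat)
    (p : trajectory I) : Prop :=
  if p is (e, s) :: p' then
    [/\ edge e, e.1 = v, t <= s, t < s -> vel v = 0%R
      & moves g e.2 (s + dur e) p']
  else v = g.

Definition feasible (R : realType) (I : instance R) (v : vertex I) (t : nat)
    (g : vertex I) (p : trajectory I) : Prop :=
  p <> [::] /\ moves g v t p.

(* [t] is the time at which the agent is ready to start the first move of p. *)
Fixpoint collision_free (R : realType) (I : instance R) (t : nat)
    (p : trajectory I) : Prop :=
  if p is (e, s) :: p' then
    [/\ collision_free_transition e s,
        t < s -> forall x, t <= x <= s -> in_SI x (SIv e.1)
      & collision_free (s + dur e) p']
  else True.

Fixpoint arrival_time (R : realType) (I : instance R) (t : nat)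
    (p : trajectory I) : nat :=
  if p is (e, s) :: p' then arrival_time (s + dur e) p' else t.

(* The empty sequence of moves gives h <= 0 at the goal. *)
Definition admissible (R : realType) (I : instance R)
    (h : vertex I -> R) : Prop :=
  forall v t p, in_SI t (SIv v) -> moves (vgoal I) v t p ->
    collision_free t p -> (h v <= (arrival_time t p)%:R - t%:R)%R.

Definition consistent (R : realType) (I : instance R)
    (h : vertex I -> R) : Prop :=
  forall e, edge e -> (h e.1 <= (dur e)%:R + h e.2)%R.

Definition heuristic (R : realType) (I : instance R)
    (h : vertex I -> R) : Prop :=
  [/\ forall v, (0 <= h v)%R, admissible h & consistent h].

Definition node (R : realType) (I : instance R) := (vertex I * tinterval)%type.

(* [gval n] is [Some (t n)] if n has been generated, and [None] otherwise. *)
Record state (R : realType) (I : instance R) := State {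
  gval : node I -> option nat;
  parent : node I -> option (node I);
  is_open : node I -> Prop
}.

Definition init_state (R : realType) (I : instance R) (J : tinterval) :
    state I :=
  {| gval := fun n => if n == (vstart I, J) then Some (tstart I) else None;
     parent := fun=> None;
     is_open := fun n => n = (vstart I, J) |}.

(* Departure times considered when n, with t(n) = t, is expanded towards n'.
   If [n.2] is [lb, ub], then [(t, n.2.2)] is [t, ub]. *)
Definition departure (R : realType) (I : instance R) (n : node I) (t : nat)
    (n' : node I) (tau : nat) : Prop :=
  [/\ vel n.1 = 0%R -> tmem tau (t, n.2.2),
      vel n.1 <> 0%R -> tau = t,
      collision_free_transition (n.1, n'.1) tau
    & tmem (tau + dur (n.1, n'.1)) n'.2].

Definition earliest_departure (R : realType) (I : instance R) (n : node I)
    (t : nat) (n' : node I) (tau : nat) : Prop :=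
  departure n t n' tau /\
  (forall tau', departure n t n' tau' -> tau <= tau').

(* The expansion of n, with t(n) = t, yields the successor n' with arrival time
   t'. *)
Definition successor (R : realType) (I : instance R) (n : node I) (t : nat)
    (n' : node I) (t' : nat) : Prop :=
  [/\ edge (n.1, n'.1), n'.2 \in SIv n'.1
    & exists2 tau, earliest_departure n t n' tau & t' = tau + dur (n.1, n'.1)].

Definition improves (t' : nat) (g : option nat) : Prop :=
  if g is Some t then t' < t else True.

(* Distinct pairs of an outgoing edge and a safe interval of its target lead to
   distinct nodes, none of them n, so all successors are processed at once: the
   order in which they are enumerated is irrelevant. *)
Definition expand (R : realType) (I : instance R) (n : node I) (t : nat)
    (s s' : state I) : Prop :=
  forall n' : node I,
  [/\ is_open s' n' <-> (is_open s n' /\ n' <> n) \/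
        (gval s n' = None /\ exists t', successor n t n' t'),
      forall t', successor n t n' t' -> improves t' (gval s n') ->
        gval s' n' = Some t' /\ parent s' n' = Some n
    & ~ (exists2 t', successor n t n' t' & improves t' (gval s n')) ->
        gval s' n' = gval s n' /\ parent s' n' = parent s n'].

(* n may be extracted from OPEN: it minimizes t(n) + h(v).  Ties are broken
   arbitrarily. *)
Definition extractable (R : realType) (I : instance R) (h : vertex I -> R)
    (s : state I) (n : node I) (t : nat) : Prop :=
  [/\ is_open s n, gval s n = Some t
    & forall m tm, is_open s m -> gval s m = Some tm ->
        (t%:R + h n.1 <= tm%:R + h m.1)%R].

(* [Solved n s]: the solution is read off from n along the parents in s. *)
Inductive config (R : realType) (I : instance R) :=
| Running of state I
| Solved of node I & state I
| Failed.
Arguments Failed {R I}.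

Inductive sipp_step (R : realType) (I : instance R) (h : vertex I -> R) :
    config I -> config I -> Prop :=
| StepFail s :
    (forall n, ~ is_open s n) -> sipp_step h (Running s) Failed
| StepSolve s n t :
    extractable h s n t -> n.1 = vgoal I ->
    sipp_step h (Running s) (Solved n s)
| StepExpand s s' n t :
    extractable h s n t -> n.1 <> vgoal I -> expand n t s s' ->
    sipp_step h (Running s) (Running s').

Definition sipp_initial (R : realType) (I : instance R) (c : config I) : Prop :=
  exists J, [/\ J \in SIv (vstart I), tmem (tstart I) J
              & c = Running (init_state I J)].

Definition sipp_reachable (R : realType) (I : instance R) (h : vertex I -> R)
    (c : config I) : Prop :=
  exists2 c0, sipp_initial c0 & clos_refl_trans (config I) (sipp_step h) c0 c.

Definition sipp_terminates (R : realType) (I : instance R)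
    (h : vertex I -> R) : Prop :=
  ~ exists run : nat -> config I,
      sipp_initial (run 0) /\ forall k, sipp_step h (run k) (run k.+1).

(* All executions, whatever the tie-breaking, are finite and end in failure. *)
Definition sipp_fails (R : realType) (I : instance R)
    (h : vertex I -> R) : Prop :=
  sipp_terminates h /\
  (forall c, sipp_reachable h c -> (forall c', ~ sipp_step h c c') -> c = Failed).

(* Main.v *)
Require Import Defs.
From mathcomp Require Import all_boot all_order all_algebra.
From mathcomp Require Import reals.
From Stdlib Require Import Relation_Operators.

Set Implicit Arguments.
Unset Strict Implicit.
Unset Printing Implicit Defensive.

Import Order.TTheory GRing.Theory Num.Theory.

(** On the path start -> mid -> goal, with all durations 1, the agent can wait
    at start but not at mid, and the edge from mid to goal is free at time 2
    only.  Waiting one step at start solves the instance.  SIPP however keeps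
    only the earliest arrival time 1 at mid, from which no move is possible;
    the arrival at time 2 lies in the same safe interval of mid and is never
    considered. *)

(** [option bool] serves as a ready-made type with exactly three elements and decidable equality. *)
Definition start : option bool := Some false.
Definition mid : option bool := None.
Definition goal : option bool := Some true.

Definition always : tinterval := (0, None).

Definition path_edge (e : option bool * option bool) : bool :=
  (e == (start, mid)) || (e == (mid, goal)).

Definition path_SIe (e : option bool * option bool) : seq tinterval :=
  if e.1 == mid then [:: (2, Some 2)] else [:: always].

(** Velocity 1 at [mid] and 0 elsewhere: the first edge accelerates, the second decelerates. *)
Definition path_vel (R : realType) (v : option bool) : R := (v == mid)%:R%R.

Lemma nonempty_itvs1 J t : tmem t J -> nonempty_itvs [:: J].
Proof. by move=> tJ K; rewrite inE => /eqP ->; exists t. Qed.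

Lemma disjoint_itvs1 J : disjoint_itvs [:: J].
Proof. by move=> K L; rewrite !inE => /eqP -> /eqP ->; rewrite eqxx. Qed.

Lemma separated_itvs1 J : separated_itvs [:: J].
Proof. by move=> K L; rewrite !inE => /eqP -> /eqP ->; rewrite eqxx. Qed.

Lemma path_edge_finite v :
  exists s : seq (option bool), forall u, path_edge (v, u) -> u \in s.
Proof. by exists [:: start; mid; goal] => -[[]|]. Qed.

Lemma path_edge_irrefl e : path_edge e -> e.2 != e.1.
Proof. by case/orP=> /eqP ->. Qed.

Lemma path_SIe_uniq e : uniq (path_SIe e).
Proof. by rewrite /path_SIe; case: ifP. Qed.

Lemma path_SIe_nonempty e : nonempty_itvs (path_SIe e).
Proof.
(* Time 2 lies in both possible intervals, [2, 2] and [always]. *)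
by rewrite /path_SIe; case: ifP => _; apply: (@nonempty_itvs1 _ 2).
Qed.

Lemma path_SIe_disjoint e : disjoint_itvs (path_SIe e).
Proof. by rewrite /path_SIe; case: ifP => _; apply: disjoint_itvs1. Qed.

Definition path_instance (R : realType) : instance R :=
  @Instance R (option bool) path_edge (fun=> 1) (@path_vel R)
    (fun=> [:: always]) path_SIe start goal 0
    path_edge_finite path_edge_irrefl (fun _ _ => isT)
    (fun v => ler0n R (v == mid)) (fun=> isT)
    (fun=> @nonempty_itvs1 always 0 isT) (fun=> @disjoint_itvs1 always)
    (fun=> @separated_itvs1 always) (fun e _ => path_SIe_uniq e)
    (fun e _ => @path_SIe_nonempty e) (fun e _ => @path_SIe_disjoint e) isT.

Section PathSearch.
Variables (R : realType) (h : vertex (path_instance R) -> R).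
Let I := path_instance R.
Let n0 : node I := (start, always).
Let n1 : node I := (mid, always).

(** Departure at time 0 is already collision-free, so minimality forces [tau = 0] and arrival at
    time 1. *)
Lemma successor_start n' t' : successor n0 0 n' t' <-> n' = n1 /\ t' = 1.
Proof.
split=> [[]|[-> ->]].
  case: n' => u K /=; rewrite /path_edge /= !xpair_eqE /= orbF => /eqP ->.
  rewrite inE => /eqP -> [tau [_ tau_min] ->]; split=> //.
  suff: tau <= 0 by rewrite leqn0 => /eqP ->.
  by apply: tau_min; split.
by split=> //; exists 0 => //; split.
Qed.

(** The nonzero velocity forces departure at time 1, which is outside [2, 2]. *)
Lemma successor_mid n' t' : ~ successor n1 1 n' t'.
Proof.
case=> _ _ [tau [[_ tau1 [tau_free _] _] _] _].
have vel_mid : vel (n1.1 : vertex I) <> 0%R.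
  by rewrite /= /path_vel eqxx; apply/eqP; rewrite oner_eq0.
by move: tau_free; rewrite (tau1 vel_mid).
Qed.

(** Invariant after [k] steps: expand [n0], expand [n1], fail. Only OPEN and the needed arrival time
    are recorded, since [expand] fixes states pointwise. No run reaches stage 4. *)
Definition stage (k : nat) (c : config I) : Prop :=
  match k with
  | 0 => c = Running (init_state I always)
  | 1 => exists s, [/\ c = Running s, forall n, is_open s n <-> n = n1
                     & gval s n1 = Some 1]
  | 2 => exists2 s, c = Running s & forall n, ~ is_open s n
  | 3 => c = Failed
  | _ => False
  end.

Lemma stage_initial c : sipp_initial c -> stage 0 c.
Proof. by case=> J []; rewrite inE => /eqP -> _ ->. Qed.

Lemma stage_step k c c' : stage k c -> sipp_step h c c' -> stage k.+1 c'.
Proof.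
case: k => [|[|[|[|//]]]] /=.
- move=> -> st; inversion st as [s none|s n t ext goaln|s s' n t ext _ ex].
  + by case: (none n0).
  + by case: ext goaln => -> _ _.
  case: ext => /= nE; rewrite nE eqxx => -[tE] _; subst n t.
  exists s'; split=> // [n|]; last first.
    case: (ex n1) => _ gE _; case: (gE 1) => //.
    by apply/successor_start.
  (* The new OPEN loses [n0], its only node, and gains the only successor [n1]. *)
  case: (ex n) => -> _ _ /=; split=> [[[nn0 /(_ nn0)]//|[_ [t' succ]]]|->].
    by case/successor_start: succ.
  by right; split=> //; exists 1; apply/successor_start.
- move=> [s [-> openE g1]] st.
  inversion st as [s0 none|s0 n t ext goaln|s0 s' n t ext _ ex].
  + by case: (none n1); apply/openE.
  + by case: ext goaln => /openE -> _ _.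
  case: ext => /openE nE; rewrite nE g1 => -[tE] _; subst n t.
  exists s' => // n; case: (ex n) => -> _ _ [[/openE nn1 /(_ nn1)]//|].
  by case=> _ [t' /successor_mid].
- move=> [s -> none] st; inversion st as [|s0 n t ext|s0 s' n t ext] => //.
    by case: ext => /none.
  by case: ext => /none.
- by move=> -> st; inversion st.
Qed.

(** Each stage before failure has a next step, shown by exhibiting the state it leads to; hence a
    stuck configuration has failed. *)
Lemma stage_progress k c : stage k c -> (forall c', ~ sipp_step h c c') ->
  c = Failed.
Proof.
case: k => [|[|[|[|//]]]] /=.
- move=> -> stuck.
  pose s' : state I := {|
    gval := fun n => if n == n1 then Some 1
                     else gval (init_state I always) n;
    parent := fun n => if n == n1 then Some n0 else None;
    is_open := fun n => n = n1 |}.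
  case: (stuck (Running s')); apply: (@StepExpand _ _ _ _ _ n0 0) => //.
    (* OPEN is a singleton, so minimality of the extracted node is reflexivity. *)
    by split=> // m tm /= ->; rewrite eqxx => -[<-].
  move=> n; split.
  + split=> [->|[[nn0 /(_ nn0)]//|[_ [t' /successor_start[]//]]]].
    by right; split=> //; exists 1; apply/successor_start.
  + by move=> t' /successor_start[-> ->].
  + move=> nosucc /=; case: eqP => // nE.
    by case: nosucc; exists 1; [apply/successor_start | rewrite nE].
- move=> [s [-> openE g1]] stuck.
  (* Without successors, expanding [n1] only empties OPEN. *)
  pose s' : state I := State (gval s) (parent s) (fun=> False).
  case: (stuck (Running s')); apply: (@StepExpand _ _ _ _ _ n1 1) => //.
    split; [exact/openE | exact: g1 |].
    by move=> m tm /openE ->; rewrite g1 => -[<-].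
  move=> n; split=> //.
  + by split=> // -[[/openE nn1 /(_ nn1)]//|[_ [t' /successor_mid]]].
  + by move=> t' /successor_mid.
- by move=> [s -> none] stuck; case: (stuck Failed); apply: StepFail.
- by [].
Qed.

Lemma stage_reachable c : sipp_reachable h c -> exists k, stage k c.
Proof.
case=> c0 /stage_initial c0P steps.
have {c0P} : exists k, stage k c0 by exists 0.
elim: steps => [x y xy [k kx]|//|x y z _ IHxy _ IHyz /IHxy/IHyz//].
by exists k.+1; apply: stage_step kx xy.
Qed.

Lemma sipp_fails_path : sipp_fails h.
Proof.
split=> [[run [init steps]]|c /stage_reachable[k]]; last exact: stage_progress.
have stage_run k : stage k (run k).
  by elim: k => [|k IHk]; [exact: stage_initial | exact: stage_step (steps k)].
(* An infinite run would be in stage 4, which is [False]. *)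
exact: (stage_run 4).
Qed.

End PathSearch.

Theorem mainTheorem3 (R : realType) :
  exists I : instance R,
    [/\ exists e : vertex I * vertex I, edge e /\ accelerating e,
        exists e : vertex I * vertex I, edge e /\ decelerating e,
        exists v : vertex I, vel v <> 0%R,
        exists p : trajectory I,
          feasible (vstart I) (tstart I) (vgoal I) p /\
          collision_free (tstart I) p
      & forall h : vertex I -> R, heuristic h -> sipp_fails h].
Proof.
exists (path_instance R); split.
- by exists (start, mid); split=> //; apply: ltr01.
- by exists (mid, goal); split=> //; apply: ltr01.
- by exists mid; apply/eqP/oner_neq0.
(* Waiting at [start] until time 1 gives arrival at [mid] at time 2, when the second edge is free,
   so no wait occurs there. *)
- by exists [:: ((start, mid), 1); ((mid, goal), 2)].
- by move=> h _; apply: sipp_fails_path.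
Qed.
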